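(* Let $K$ be a field of arbitrary characteristic, let $L/K$ be a finite field extension of degree $n:=[L:K]<\infty$ and let $E:=E(L/K)\simeq M_n(K)$. Then: 1. $L\in\mathrm{Max}_s(E)$. 2. $\mathcal{A}(E,L)=\mathcal{A}(E,L,sim)=\{E(L/M)\mid M\in\mathcal{F}(L/K)\}$. 3. The map $$\mathcal{F}(L/K)\to\mathcal{A}(E,L)=\mathcal{A}(E,L,sim),\quad M\mapsto C_E(M)=E(L/M)$$ is a bijection with inverse $B\mapsto C_E(B)$. 4. For all fields $M\in\mathcal{F}(L/K)$, $[M:K]\,\dim_K(C_E(M))=[L:K]^2$.
   Context: $E(L/K)=\mathrm{End}_K(L)$ is the algebra of $K$-linear endomorphisms of $L$, and $L$ is viewed as a subfield of $E(L/K)$ via multiplication operators. $\mathcal{F}(L/K)$ is the set of intermediate fields $K\subseteq M\subseteq L$, and $E(L/M)=\mathrm{End}_M(L)\subseteq E(L/K)$. $\mathcal{A}(E,L)$ (resp. $\mathcal{A}(E,L,sim)$) is the set of all (resp. all simple) $K$-subalgebras of $E$ containing $L$. $C_E(S)$ is the centralizer of $S$ in $E$. For a central simple finite dimensional $K$-algebra $A$, its degree is $\mathrm{Deg}(A)=\sqrt{\dim_K A}$, and a subfield $F\supseteq K$ of $A$ is called strictly (strongly) maximal if $[F:K]=\mathrm{Deg}(A)$; $\mathrm{Max}_s(A)$ is the set of strictly maximal subfields of $A$. *)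

(* Defs.v *)
From HB Require Import structures.
From mathcomp Require Import all_boot all_order all_algebra all_field.

Set Implicit Arguments.
Unset Strict Implicit.
Unset Printing Implicit Defensive.

Import GRing.Theory Num.Theory.

(* The algebra E(L/K) is 'End(L) with the structure of FalgLfun, in which     *)
(* f * g is composition in diagrammatic order: (f * g) x = g (f x). Unital    *)
(* subalgebras, two-sided ideals, centralisers, centers and subfields are the *)
(* same subspaces for this product and for the opposite one.                  *)
Import FalgLfun.

Local Open Scope ring_scope.

Section Algebras.

Variables (K : fieldType) (A : falgType K).
Implicit Types (F I V : {vspace A}) (B : {aspace A}).

Definition two_sided_ideal B I : Prop :=
  [/\ (I <= B)%VS, (B * I <= I)%VS & (I * B <= I)%VS].

(* The zero algebra is excluded by the type {aspace A}; see adim_gt0. *)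
Definition simple_aspace B : Prop :=
  forall I, two_sided_ideal B I -> I = 0%VS \/ I = B.

Definition central_simple : Prop :=
  'Z({:A})%VS = 1%VS /\ simple_aspace {:A}%AS.

Definition Deg : algC := sqrtC (\dim {:A})%:R.

(* A K-subspace containing 1 contains K. *)
Definition is_subfield F : Prop :=
  [/\ 1 \in F,
      {in F &, forall u v, u * v \in F},
      {in F &, commutative *%R}
    & {in F, forall u, u != 0 -> exists2 v, v \in F & u * v = 1}].

Definition Max_s F : Prop :=
  [/\ central_simple, is_subfield F & (\dim F)%:R = Deg].

(* When 1 \in V, the identity algid B of a B containing V is 1. *)
Definition subalg_over V B : bool := (V <= B)%VS.

Definition simple_subalg_over V B : Prop := subalg_over V B /\ simple_aspace B.

End Algebras.

Section Endomorphisms.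

Variables (K : fieldType) (L : fieldExtType K).
Implicit Types (M : {vspace L}) (f : 'End(L)).

(* M viewed inside E(L/K): the operators x |-> u * x for u in M. *)
Definition mulops M : {vspace 'End(L)} := (linfun (@amull K L) @: M)%VS.

Definition lindefect (u x : L) : 'Hom('End(L), L) :=
  linfun (fun f : 'End(L) => f (u * x) - u * f x).

(* M-linearity tested on K-bases of M and L; see End_overP. *)
Definition End_over M : {vspace 'End(L)} :=
  (\bigcap_(i < \dim M) \bigcap_(j < \dim {:L})
     lker (lindefect (vbasis M)`_i (vbasis {:L})`_j))%VS.

Lemma lindefectE u x f : lindefect u x f = f (u * x) - u * f x.
Proof.
rewrite /lindefect; set h := (fun g : 'End(L) => _).
have h_lin : linear h.
  move=> a g1 g2; rewrite /h !add_lfunE !scale_lfunE mulrDr -scalerAr.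
  by rewrite scalerBr opprD addrACA.
pose hL := GRing.isSemilinear.Build K 'End(L) L _ h
  (GRing.semilinear_linear h_lin).
pose h' : {linear 'End(L) -> L} := HB.pack h hL.
by rewrite -[h]/(h' : _ -> _) lfunE.
Qed.

Lemma End_overP M f :
  reflect (forall u x, u \in M -> f (u * x) = u * f x) (f \in End_over M).
Proof.
rewrite memvE; apply: (iffP subv_bigcapP) => [fM u x Mu | fM i _].
  have fb (i : 'I_(\dim M)) y : f ((vbasis M)`_i * y) = (vbasis M)`_i * f y.
    rewrite {1 2}(coord_vbasis (memvf y)) mulr_sumr !linear_sum mulr_sumr.
    apply: eq_bigr => j _; rewrite -scalerAr !linearZ /= -scalerAr.
    have /subv_bigcapP/(_ j isT) := fM i isT.
    by rewrite -memvE memv_ker lindefectE subr_eq0 => /eqP->.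
  rewrite {1 2}(coord_vbasis Mu) !mulr_suml linear_sum.
  by apply: eq_bigr => i _; rewrite -!scalerAl linearZ /= fb.
apply/subv_bigcapP=> j _; rewrite -memvE memv_ker lindefectE subr_eq0.
by rewrite fM // vbasis_mem // mem_nth // size_tuple.
Qed.

Fact End_over_is_aspace M : is_aspace (End_over M).
Proof.
rewrite /is_aspace has_algid1 /=; last first.
  by apply/End_overP=> u x _; rewrite !id_lfunE.
apply/prodvP=> f g /End_overP fM /End_overP gM; apply/End_overP=> u x Mu.
by rewrite !lfun_mulE fM // gM.
Qed.
Canonical End_over_aspace M : {aspace 'End(L)} := ASpace (End_over_is_aspace M).

End Endomorphisms.

(* Main.v *)
(* Let B be a subalgebra of E containing L. The operators in L commuting with *)
(* B form a field M, and B is contained in E(L/M). Conversely, an M-linear g  *)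
(* lies in any left ideal J of B such that g y = 0 whenever J kills y. This   *)
(* goes by induction on the dimension of J: pick b in J and x in L with       *)
(* b x = 1, subtract (g x) b from g, and replace J by the f in J with         *)
(* f x = 0. If these all kill y, then f y = (b y) (f x) for f in J, so that   *)
(* b y is in M and J kills y - (b y) x.                                       *)
(*   A nonzero two-sided ideal of B kills no nonzero y, because L is a field  *)
(* contained in B, so it contains E(L/M); hence B = E(L/M) and B is simple.   *)
(* That M is recovered from E(L/M), and the dimension of E(L/M), follow from  *)
(* the coordinate functions of an M-basis of L.                               *)
Require Import Defs.
From HB Require Import structures.
From mathcomp Require Import all_boot all_order all_algebra all_field.

Set Implicit Arguments.
Unset Strict Implicit.
Unset Printing Implicit Defensive.

Import GRing.Theory Num.Theory.
Import FalgLfun.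
Local Open Scope ring_scope.

Import passmx.

(** A double centralizer argument. For a field M, C(M) is E(L/M); for a subalgebra B containing L,
    C(B) lies in C(L) = L ([cent_mulopsf]), hence comes from the field [cent_field B]. The two maps
    are mutually inverse by [End_over_cent_field], a form of Jacobson density resting on
    [mem_left_ideal], and by [cent_field_End_over]. The ideal argument behind the former also yields
    simplicity; M-coordinates on L yield the latter and the dimension formula. *)

Section MulOps.

Variables (K : fieldType) (L : fieldExtType K).
Implicit Types (M : {vspace L}) (f g : 'End(L)) (u x : L).
Implicit Types (B : {aspace 'End(L)}) (I J : {vspace 'End(L)}).

Let L_ops : {vspace 'End(L)} := mulops {:L}.

(** * Multiplication operators and their centralizers *)

Lemma amullE u x : amull u x = u * x.
Proof. by rewrite lfunE. Qed.

Lemma linfun_amullE u : linfun (@amull K L) u = amull u.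
Proof. by rewrite lfunE. Qed.

Lemma memv_mulops M u : (amull u \in mulops M) = (u \in M).
Proof.
apply/memv_imgP/idP=> [[v Mv] | Mu]; last by exists u; rewrite ?linfun_amullE.
by rewrite linfun_amullE => /amull_inj->.
Qed.

Lemma mulopsP M f :
  reflect (exists2 u, u \in M & f = amull u) (f \in mulops M).
Proof.
apply: (iffP memv_imgP) => [] [u Mu ->]; exists u => //;
by rewrite linfun_amullE.
Qed.

Lemma dim_mulops M : \dim (mulops M) = \dim M.
Proof.
apply: limg_dim_eq; apply/eqP; rewrite -subv0; apply/subvP=> u /memv_capP[_].
rewrite memv_ker linfun_amullE memv0 => /eqP u0.
by rewrite -[u]mulr1 -amullE u0 zero_lfunE.
Qed.

Lemma amulls_in B u : subalg_over L_ops B -> amull u \in B.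
Proof. by move/subvP; apply; rewrite memv_mulops memvf. Qed.

Lemma amull_eq1 : amull 1 = 1 :> 'End(L).
Proof. by rewrite amull1. Qed.

Lemma subalg_over1 B : subalg_over L_ops B -> 1 \in B.
Proof. by move=> sLB; rewrite -amull_eq1 amulls_in. Qed.

Lemma cent_mulops M : 'C(mulops M)%VS = End_over M.
Proof.
apply/vspaceP=> f.
apply/centvP/End_overP=> [cMf u x Mu | fM _ /mulopsP[u Mu ->]].
  have := cMf (amull u); rewrite memv_mulops => /(_ Mu)/lfunP/(_ x).
  by rewrite !lfun_mulE !amullE.
by apply/lfunP=> x; rewrite !lfun_mulE !amullE fM.
Qed.

Lemma End_over_contains_mulops M : subalg_over L_ops (End_over_aspace M).
Proof.
apply/subvP=> _ /mulopsP[u _ ->]; apply/End_overP=> v x _.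
by rewrite !amullE mulrCA.
Qed.

(** An L-linear operator [f] is multiplication by [f 1]. *)
Lemma cent_mulopsf : 'C(L_ops)%VS = L_ops.
Proof.
rewrite cent_mulops; apply/eqP; rewrite eqEsubv.
rewrite [X in _ && X]End_over_contains_mulops andbT.
apply/subvP=> f /End_overP fL; apply/mulopsP; exists (f 1); first exact: memvf.
by apply/lfunP=> x; rewrite amullE -{1}[x]mulr1 fL ?memvf // mulrC.
Qed.

(** * The field attached to a subalgebra *)

Definition cent_field_vspace B : {vspace L} :=
  (linfun (@amull K L) @^-1: 'C(B))%VS.

Lemma cent_fieldP B u :
  reflect (forall c x, c \in B -> c (u * x) = u * c x)
          (u \in cent_field_vspace B).
Proof.
rewrite -memv_preim linfun_amullE.
apply: (iffP centvP) => [cBu c x /cBu/lfunP/(_ x) | cBu c Bc].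
  by rewrite !lfun_mulE !amullE.
by apply/lfunP=> x; rewrite !lfun_mulE !amullE cBu.
Qed.

Fact cent_field_is_aspace B : is_aspace (cent_field_vspace B).
Proof.
rewrite /is_aspace has_algid1 /=; last first.
  by apply/cent_fieldP=> c x _; rewrite !mul1r.
apply/prodvP=> u v /cent_fieldP cBu /cent_fieldP cBv.
by apply/cent_fieldP=> c x Bc; rewrite -!mulrA cBu // cBv.
Qed.
(** Subalgebras of the finite extension L are closed under inverses, hence are subfields. *)
Definition cent_field B : {subfield L} := ASpace (cent_field_is_aspace B).

(** As B contains L, C(B) lies in C(L) = L, so pulling it back to L loses nothing. *)
Lemma mulops_cent_field B :
  subalg_over L_ops B -> mulops (cent_field B) = 'C(B)%VS.
Proof.
move=> sLB; apply: lpreimK; apply: subv_trans (_ : L_ops <= _)%VS.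
  by rewrite -cent_mulopsf centvC (subv_trans sLB) // -centvC.
exact: limgS (subvf _).
Qed.

Lemma sub_End_over_cent_field B : (B <= End_over (cent_field B))%VS.
Proof.
by apply/subvP=> f Bf; apply/End_overP=> u x /cent_fieldP/(_ f x Bf).
Qed.

(** * Left ideals and density *)

Definition lfun_at x f : L := f x.

Fact lfun_at_is_linear x : linear (lfun_at x).
Proof. by move=> a f g; rewrite /lfun_at add_lfunE scale_lfunE. Qed.

HB.instance Definition _ x := GRing.isSemilinear.Build K 'End(L) L _ (lfun_at x)
  (GRing.semilinear_linear (lfun_at_is_linear x)).

(* As f * c is c after f, J * B <= J says that J is a left ideal for the usual *)
(* composition of operators.                                                  *)
Lemma mem_left_ideal B J g :
    subalg_over L_ops B -> (J <= B)%VS -> (J * B <= J)%VS ->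
    g \in End_over (cent_field B) ->
    (forall y, (forall f, f \in J -> f y = 0) -> g y = 0) ->
  g \in J.
Proof.
move=> sLB; have [m] := ubnP (\dim J); elim: m => // m IHm in J g *.
move=> leJm sJB JB_J gM gJ0; have [J0 | nzJ] := eqVneq J 0%VS.
  suffices ->: g = 0 by apply: mem0v.
  apply/lfunP=> y; rewrite zero_lfunE gJ0 // => f.
  by rewrite J0 memv0 => /eqP->; rewrite zero_lfunE.
have JM f c : f \in J -> c \in B -> f * c \in J.
  by move=> Jf Bc; apply: subvP JB_J _ (memv_mul Jf Bc).
have [x [b Jb bx1]] : exists x, exists2 b, b \in J & b x = 1.
  have /lfunPn[x] : vpick J != 0 by rewrite vpick0.
  rewrite zero_lfunE => nz_fx; exists x.
  exists (vpick J * amull (vpick J x)^-1).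
    by rewrite JM ?memv_pick ?amulls_in.
  by rewrite lfun_mulE amullE mulVf.
have Bb : b \in B by apply: subvP Jb.
pose J' := (J :&: lker (linfun (lfun_at x)))%VS.
have J'P f : reflect (f \in J /\ f x = 0) (f \in J').
  by rewrite memv_cap memv_ker lfunE; apply: (iffP andP) => [] [-> /eqP].
have cutM f :
    f \in End_over (cent_field B) ->
  f - b * amull (f x) \in End_over (cent_field B).
  move=> fM; rewrite memvB //; apply: subvP (sub_End_over_cent_field B) _ _.
  by rewrite memvM // amulls_in.
have J'cut f : f \in J -> f - b * amull (f x) \in J'.
  move=> Jf; apply/J'P; split; first by rewrite memvB ?JM ?amulls_in.
  by rewrite add_lfunE opp_lfunE lfun_mulE amullE bx1 mulr1 subrr.
suffices J'g: g - b * amull (g x) \in J'.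
  rewrite -[g](subrK (b * amull (g x))) memvD ?JM ?amulls_in //.
  by have /J'P[] := J'g.
apply: IHm => [||||y J'y].
- rewrite -ltnS; apply: leq_trans _ leJm.
  rewrite ltnS ltn_neqAle dimvS ?capvSl // andbT.
  apply: contraTneq Jb => dimJ'; have /eqP <- : J' == J.
    by rewrite -dimv_leqif_eq ?capvSl // dimJ'.
  by apply/J'P=> [] [_ /eqP]; rewrite bx1 oner_eq0.
- exact: subv_trans (capvSl _ _) sJB.
- apply/prodvP=> f c /J'P[Jf fx0] Bc; apply/J'P; split; first exact: JM.
  by rewrite lfun_mulE fx0 linear0.
- exact: cutM.
have byE f : f \in J -> f y = b y * f x.
  move/J'cut/J'y/eqP; rewrite add_lfunE opp_lfunE lfun_mulE amullE subr_eq0.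
  by rewrite mulrC => /eqP.
(* Apply [byE] to [c] after multiplication by [u] after [b]: its value at [x] is [c u], because
   [b x = 1]. *)
have Mby : b y \in cent_field B.
  apply/cent_fieldP=> c u Bc; have := byE (b * amull u * c).
  rewrite !lfun_mulE !amullE bx1 mulr1 mulrC; apply.
  by rewrite !JM ?amulls_in.
(* J kills [y - b y * x], hence so does [g], which is linear over [b y]. *)
have gM' : g y = b y * g x.
  rewrite -(End_overP _ _ gM) //; apply/eqP; rewrite -subr_eq0 -linearB.
  apply/eqP/gJ0 => f Jf; rewrite linearB /= byE //.
  have /End_overP -> // : f \in End_over (cent_field B).
    by apply: subvP (sub_End_over_cent_field B) _ _; apply: subvP Jf.
  exact: subrr.
by rewrite add_lfunE opp_lfunE lfun_mulE amullE gM' mulrC subrr.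
Qed.

Lemma End_over_sub_ideal B I :
  subalg_over L_ops B -> two_sided_ideal B I -> I != 0%VS ->
  (End_over (cent_field B) <= I)%VS.
Proof.
move=> sLB [sIB BI_I IB_I] nzI; apply/subvP=> g gM.
apply: (mem_left_ideal sLB sIB) => // y Iy0.
have /lfunPn[x] : vpick I != 0 by rewrite vpick0.
rewrite zero_lfunE; have [-> | nz_y] := eqVneq y 0; first by rewrite linear0.
(* Multiplication by [x / y] moves [y] to [x], where [vpick I] does not vanish. *)
case/eqP; rewrite -(Iy0 (amull (x / y) * vpick I)).
  by rewrite lfun_mulE amullE divfK.
by apply: subvP BI_I _ _; rewrite memv_mul ?memv_pick ?amulls_in.
Qed.

Lemma End_over_cent_field B :
  subalg_over L_ops B -> End_over (cent_field B) = B.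
Proof.
move=> sLB; apply/eqP; rewrite eqEsubv sub_End_over_cent_field andbT.
apply: End_over_sub_ideal => //; first by split; rewrite ?prodv_id.
by apply: contraTneq (subalg_over1 sLB) => ->; rewrite memv0 oner_eq0.
Qed.

Lemma subalg_over_simple B : subalg_over L_ops B -> simple_aspace B.
Proof.
move=> sLB I I_ideal; have [-> | nzI] := eqVneq I 0%VS; [by left | right].
apply/eqP; rewrite eqEsubv; case: (I_ideal) => -> _ _ /=.
by rewrite -{1}(End_over_cent_field sLB) End_over_sub_ideal.
Qed.

(** * Coordinates over a subfield *)

Variable M : {subfield L}.

(** An M-basis of L, with its coordinate functions viewed as operators on L. *)
Lemma subfield_coordinates :
  exists (x : 'I_(\dim_M {:L}) -> L) (p : 'I_(\dim_M {:L}) -> 'End(L)),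
  [/\ forall i, p i \in End_over M, forall i y, p i y \in M,
      forall y, y = \sum_i p i y * x i
    & forall i j, p i (x j) = (i == j)%:R].
Proof.
pose LM := fieldOver M.
have dimLM : \dim {:LM} = \dim_M {:L}.
  rewrite -(dim_aspaceOver (subvf M)); congr (\dim _).
  by apply/vspaceP=> y; rewrite mem_aspaceOver ?subvf // memvf (@memvf _ L).
rewrite -dimLM; set b : _.-tuple LM := vbasis {:LM}.
have bfree : free b := basis_free (vbasisP _).
pose p i (y : L) : L := vsval (coord b i (y : LM)).
have pM i u y : u \in M -> p i (u * y) = u * p i y.
  move=> Mu.
  by rewrite /p -[u * y]/((Subvs Mu : subvs_of M) *: (y : LM)) linearZ.
have p_lin i : linear (p i).
  move=> a y z; rewrite -[a *: y]mulr_algl /p (linearD (coord b i)) linearD /=.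
  by rewrite -!/(p i _) pM ?mulr_algl // rpredZ ?mem1v.
pose pL i : {linear L -> L} :=
  HB.pack (p i) (GRing.isSemilinear.Build K L L _ (p i)
    (GRing.semilinear_linear (p_lin i))).
have pE i y : linfun (pL i) y = p i y by rewrite lfunE.
exists (fun i => b`_i), (fun i => linfun (pL i)); split=> [i | i y | y | i j].
- by apply/End_overP=> u y Mu; rewrite !pE pM.
- by rewrite pE subvsP.
- rewrite [LHS](coord_vbasis (memvf (y : LM))); apply: eq_bigr => i _.
  by rewrite pE.
by rewrite pE /p coord_free // eq_sym; case: eqP => _ //=; apply: algid1.
Qed.

(** If [u] commutes with a coordinate [p i] for which [p i 1] is nonzero, then [u] is the quotient
    of [p i u] by [p i 1], both in M. *)
Lemma cent_field_End_over : cent_field (End_over_aspace M) = M.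
Proof.
apply/val_inj/vspaceP=> u /=.
apply/idP/idP=> [/cent_fieldP cMu | Mu]; last first.
  by apply/cent_fieldP=> c x /End_overP ->.
have [x [p [pM Mp p_sum _]]] := subfield_coordinates.
have [i nz_p1]: exists i, p i 1 != 0.
  apply/existsP; rewrite -negb_forall.
  apply: contra (oner_neq0 L) => /forallP p1.
  by rewrite [1]p_sum big1 // => i _; rewrite (eqP (p1 i)) mul0r.
have := cMu (p i) 1 (pM i); rewrite mulr1 => pu.
by rewrite -(mulfK nz_p1 u) -pu memvM ?memvV.
Qed.

(** Evaluation on an M-basis identifies E(L/M) with the families in L indexed by that basis. *)
Lemma dim_End_over : (\dim M * \dim (End_over M) = \dim {:L} ^ 2)%N.
Proof.
have [x [p [pM Mp p_sum px]]] := subfield_coordinates.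
pose ev (f : 'End(L)) := [ffun i => f (x i)].
have ev_lin : linear ev.
  by move=> a f g; apply/ffunP=> i; rewrite !ffunE add_lfunE scale_lfunE.
pose evL : {linear 'End(L) -> {ffun 'I_(\dim_M {:L}) -> L}} :=
  HB.pack ev (GRing.isSemilinear.Build K _ _ _ ev
    (GRing.semilinear_linear ev_lin)).
have evE f : linfun evL f = ev f by rewrite lfunE.
have dim_ev : \dim (linfun evL @: End_over M) = \dim (End_over M).
  apply: limg_dim_eq; apply/eqP; rewrite -subv0.
  apply/subvP=> f /memv_capP[/End_overP fM].
  rewrite memv_ker evE memv0 => /eqP/ffunP f0; apply/eqP/lfunP=> y.
  rewrite zero_lfunE [y]p_sum linear_sum big1 //= => i _.
  by have := f0 i; rewrite !ffunE fM // => ->; rewrite mulr0.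
have ev_full : (linfun evL @: End_over M)%VS = fullv.
  apply/eqP; rewrite eqEsubv subvf /=; apply/subvP=> v _.
  apply/memv_imgP; exists (\sum_i p i * amull (v i)).
    apply: memv_suml => i _.
    by rewrite memvM ?amulls_in ?End_over_contains_mulops.
  rewrite evE; apply/ffunP=> i; rewrite ffunE sum_lfunE (bigD1 i) //= big1.
    by rewrite addr0 lfun_mulE px eqxx amullE mulr1.
  by move=> j /negPf ji; rewrite lfun_mulE px ji linear0.
have dim_ffun :
  \dim {:{ffun 'I_(\dim_M {:L}) -> L}} = (\dim_M {:L} * \dim {:L})%N.
  by rewrite !dimvf; congr (_ * _)%N; apply: card_ord.
rewrite -dim_ev ev_full dim_ffun mulnA [(\dim M * _)%N]mulnC divnK //.
by rewrite field_dimS ?subvf.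
Qed.

End MulOps.

Theorem theorem2p8 (K : fieldType) (L : fieldExtType K) :
  let n := \dim {:L} in
  let E := 'End(L) in
  let LE := mulops {:L} in
  (* E is isomorphic to the matrix algebra, composition being the product *)
  (exists2 phi : {linear E -> 'M[K]_n},
     bijective phi &
     phi \1%VF = 1%:M /\
     forall f g : E, phi (g \o f)%VF = phi g *m phi f)
  /\
  (* 1 *)
  Max_s LE
  /\
  (* 2 *)
  ((forall B : {aspace E}, subalg_over LE B <-> simple_subalg_over LE B) /\
   (forall B : {aspace E},
      subalg_over LE B <->
      exists M : {subfield L}, B = End_over_aspace M))
  /\
  (* 3 *)
  ((forall M : {subfield L}, 'C(mulops M)%VS = End_over M) /\
   exists (C : {subfield L} -> {B : {aspace E} | subalg_over LE B})
          (C' : {B : {aspace E} | subalg_over LE B} -> {subfield L}),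
     [/\ forall M, val (C M) = 'C(mulops M)%AS,
         forall B, mulops (C' B) = 'C(val B)%VS,
         cancel C C' & cancel C' C])
  /\
  (* 4 *)
  (forall M : {subfield L},
     (\dim M * \dim ('C(mulops M)) = n ^ 2)%N).
Proof.
move=> n E LE.
have C_End (M : {subfield L}) := cent_mulops M.
have overP (B : {aspace E}) :
  subalg_over LE B <-> exists M : {subfield L}, B = End_over_aspace M.
  split=> [sLB | [M ->]]; last exact: End_over_contains_mulops.
  by exists (cent_field B); apply/val_inj; rewrite /= End_over_cent_field.
have sLE : subalg_over LE {:E} by exact: subvf.
split; last split; last split; last split; last first.
- by move=> M; rewrite C_End dim_End_over.
- split=> //.
  have sLC (M : {subfield L}) : subalg_over LE 'C(mulops M)%AS.
    by rewrite /subalg_over /= C_End; apply: End_over_contains_mulops.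
  have eqC (M : {subfield L}) : 'C(mulops M)%AS = End_over_aspace M.
    exact/val_inj/C_End.
  exists (fun M : {subfield L} => exist _ 'C(mulops M)%AS (sLC M)).
  exists (fun B => cent_field (val B)).
  split=> [// | [B sLB] | M | [B sLB]].
  - exact: mulops_cent_field.
  - by rewrite /= eqC cent_field_End_over.
  by apply/val_inj/val_inj/(etrans (C_End _))/End_over_cent_field.
- split=> // B; split=> [sLB | []//]; split=> //.
  exact: subalg_over_simple.
- split.
  + split; last exact: subalg_over_simple.
    apply/eqP; rewrite eqEsubv; apply/andP; split; last first.
      rewrite subv_cap subvf; apply/subvP=> _ /vlineP[k ->].
      by rewrite memvZ ?centv1.
    rewrite (subv_trans (capvSr _ _)) // -(mulops_cent_field sLE).
    (* E is E(L/K), so its field is K. *)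
    suffices -> : cent_field {:E} = 1%AS.
      by rewrite /= /mulops limg_line linfun_amullE amull_eq1.
    rewrite -[RHS]cent_field_End_over; congr cent_field.
    apply/val_inj/esym/eqP; rewrite eqEsubv subvf; apply/subvP=> f _ /=.
    apply/End_overP=> _ y /vlineP[k ->].
    by rewrite -!scalerAl !mul1r linearZ.
  + split.
    * by rewrite -amull_eq1 memv_mulops memvf.
    * move=> _ _ /mulopsP[u _ ->] /mulopsP[v _ ->].
      by rewrite -[_ * _]amullM memv_mulops memvf.
    * move=> _ _ /mulopsP[u _ ->] /mulopsP[v _ ->].
      by rewrite -[LHS]amullM mulrC amullM.
    move=> _ /mulopsP[u _ ->] nz_u; exists (amull u^-1).
      by rewrite memv_mulops memvf.
    rewrite -[_ * _]amullM mulVf ?amull_eq1 //.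
    by apply: contraNneq nz_u => ->; rewrite linear0.
  by rewrite dim_mulops /Deg !dimvf natrM -expr2 sqrCK ?ler0n.
pose e := vbasis {:L}; have basisL := vbasisP {:L}.
(* [mxof] acts on row vectors and so reverses composition; the transpose restores the order. *)
exists (trmx \o mxof e e : {linear 'End(L) -> 'M_n}).
  exists (hommx e e \o trmx) => X /=; first by rewrite trmxK mxofK.
  by rewrite hommxK ?trmxK.
split=> [|f g] /=; first by rewrite mxof1 ?trmx1 // (basis_free basisL).
by rewrite (mxof_comp _ _ basisL) trmx_mul.
Qed.
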